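(* For every integer $k\geq 1$, the half-graph $H_k$ is locatable and satisfies $\gamma_{OL}(H_k)=2k$.
   Context: All graphs are simple, finite and undirected. $N(v)$ denotes the open neighbourhood of a vertex $v$, i.e. the set of vertices adjacent to $v$ (so $v\notin N(v)$). An open neighbourhood locating-dominating set (OLD set) of a graph $G$ is a set $S\subseteq V(G)$ such that every vertex $v\in V(G)$ has a neighbour in $S$ (i.e. $N(v)\cap S\neq\emptyset$), and for any two distinct vertices $v,w\in V(G)$, $N(v)\cap S\neq N(w)\cap S$. A graph is locatable if it has no isolated vertices and no pair of open twins, where open twins are two distinct vertices with the same open neighbourhood; equivalently, a graph is locatable if it admits an OLD set. For a locatable graph $G$, $\gamma_{OL}(G)$ denotes the smallest size of an OLD set of $G$. For an integer $k\geq 1$, the half-graph $H_k$ is the bipartite graph with parts $\{v_1,\ldots,v_k\}$ and $\{w_1,\ldots,w_k\}$ (with $2k$ vertices in total), with an edge between $v_i$ and $w_j$ if and only if $i\leq j$. *)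

(* Defs.v *)
From mathcomp Require Import all_boot.

Set Implicit Arguments.
Unset Strict Implicit.
Unset Printing Implicit Defensive.

Record sgraph := SGraph {
  vertex :> finType;
  adj : rel vertex;
  adj_sym : symmetric adj;
  adj_irrefl : irreflexive adj
}.

Section OpenLocatingDomination.
Variable G : sgraph.
Implicit Types (v w : G) (S : {set G}).

Definition open_nbhd v : {set G} := [set w | adj v w].

Definition OLD_set S : bool :=
  [forall v, open_nbhd v :&: S != set0] &&
  [forall v, forall w,
     (v != w) ==> (open_nbhd v :&: S != open_nbhd w :&: S)].

Definition isolated v : bool := open_nbhd v == set0.

Definition open_twins v w : bool := (v != w) && (open_nbhd v == open_nbhd w).

Definition locatable : bool :=
  ~~ [exists v, isolated v] && ~~ [exists v, exists w, open_twins v w].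

(* The value is meaningful only when G has an OLD set, that is, when G is
   locatable; it is 0 by convention otherwise. *)
Definition gamma_OL : nat :=
  if [pick S | OLD_set S] is Some S0
  then #|[arg min_(S < S0 | OLD_set S) #|S| ]|
  else 0.

End OpenLocatingDomination.

Section HalfGraph.
Variable k : nat.

(* [inl i] stands for v_(i+1) and [inr j] for w_(j+1): ordinals start at 0,
   which does not affect the comparison of indices. *)
Definition half_adj : rel ('I_k + 'I_k)%type := fun x y =>
  match x, y with
  | inl i, inr j | inr j, inl i => i <= j
  | _, _ => false
  end.

Lemma half_adj_sym : symmetric half_adj.
Proof. by case=> i [] j. Qed.

Lemma half_adj_irrefl : irreflexive half_adj.
Proof. by case. Qed.

Definition half_graph : sgraph := SGraph half_adj_sym half_adj_irrefl.

End HalfGraph.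

(* Main.v *)
Require Import Defs.
From mathcomp Require Import all_boot.

Set Implicit Arguments.
Unset Strict Implicit.
Unset Printing Implicit Defensive.

(** In any graph a vertex [x] lies in every OLD set as soon as either [x] is
    the only neighbour of some vertex (only [x] can then dominate it), or [x]
    is the only element in which two nested open neighbourhoods differ (only
    [x] can then separate them).  In a half-graph the open neighbourhoods of
    the vertices of one part form a chain of subsets of the other part, growing
    by exactly one vertex at a time and starting with a singleton.  Hence every
    vertex is forced in one of the two ways: the first element of each chain by
    domination ([OLD_set_dominator]), the others by separation
    ([OLD_set_separator]).  So the only possible OLD set is the whole vertex
    set, which is an OLD set because the neighbourhoods in the two chains are
    nonempty and pairwise distinct. *)

Section ForcedVertices.
Variable G : sgraph.
Implicit Types (v w x : G) (S : {set G}).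

Lemma OLD_set_dominator S v x :
  OLD_set S -> open_nbhd v = [set x] -> x \in S.
Proof.
move=> /andP[/forallP/(_ v) /set0Pn[y]] + _ Nv.
by rewrite Nv !inE => /andP[/eqP->].
Qed.

Lemma OLD_set_separator S v w x :
  OLD_set S -> v != w -> open_nbhd v = x |: open_nbhd w -> x \in S.
Proof.
move=> /andP[_ /forallP/(_ v)/forallP/(_ w)/implyP sep] /sep + Nv.
apply: contraNT => xNS; rewrite Nv setIUl.
suff -> : [set x] :&: S = set0 by rewrite set0U.
by apply/eqP; rewrite setI_eq0 disjoints1.
Qed.

Lemma OLD_setT : OLD_set [set: G] = locatable G.
Proof.
rewrite /OLD_set /locatable !negb_exists; congr (_ && _).
  by apply: eq_forallb => v; rewrite setIT.
apply: eq_forallb => v; rewrite negb_exists; apply: eq_forallb => w.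
by rewrite !setIT /open_twins negb_and implybE.
Qed.

Lemma gamma_OL_card :
  locatable G -> (forall S, OLD_set S -> S = setT) -> gamma_OL G = #|G|.
Proof.
rewrite -OLD_setT => OLD_T only_T; rewrite /gamma_OL.
case: pickP => [S0 OLD_S0|/(_ setT)]; last by rewrite OLD_T.
by case: arg_minnP => // S /only_T -> _; rewrite cardsT.
Qed.

End ForcedVertices.

Section HalfGraphOLD.
Variable k : nat.
Local Notation H := (half_graph k).
Implicit Types (i j : 'I_k) (S : {set H}).

(** Each chain is strictly monotone: the vertices [inl i] and [inr i] are
    adjacent, so an equality of neighbourhoods within a part gives both
    inequalities between the indices; across the parts, neighbourhoods are
    nonempty subsets of opposite parts. *)
Lemma half_graph_locatable : locatable H.
Proof.
apply/andP; split.
  apply/existsPn => -[] i; apply/set0Pn.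
    by exists (inr i : H); rewrite inE /=.
  by exists (inl i : H); rewrite inE /=.
apply/existsPn => x; apply/existsPn => y; rewrite negb_and negbK orbC -implybE.
apply/implyP => /eqP/setP eqN.
case: x y eqN => i [] j eqN.
- have := eqN (inr i); have := eqN (inr j); rewrite !inE /= !leqnn.
  by move=> le_ij /esym le_ji; apply/eqP; congr inl; apply/val_inj/anti_leq/andP.
- by have := eqN (inr i); rewrite !inE /= leqnn.
- by have := eqN (inl i); rewrite !inE /= leqnn.
- have := eqN (inl i); have := eqN (inl j); rewrite !inE /= !leqnn.
  by move=> le_ji /esym le_ij; apply/eqP; congr inr; apply/val_inj/anti_leq/andP.
Qed.

(** The neighbourhoods of the [inr j] grow with [j], so the chain is climbed
    from the smallest index: that of [inr i] gains exactly [inl i]. *)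
Lemma inl_in_OLD_set S i : OLD_set S -> (inl i : H) \in S.
Proof.
case: i => -[|m] ltmk OLD_S.
  apply: (OLD_set_dominator (v := inr (Ordinal ltmk) : H) OLD_S).
  by apply/setP => -[] j; rewrite !inE //= leqn0.
apply: (OLD_set_separator (v := inr (Ordinal ltmk) : H)
                          (w := inr (Ordinal (ltnW ltmk)) : H) OLD_S).
  by apply/eqP => -[] /eqP; rewrite gtn_eqF.
by apply/setP => -[] j; rewrite !inE //= leq_eqVlt ltnS.
Qed.

(** The neighbourhoods of the [inl i] shrink as [i] grows, so here the chain
    starts at the largest index. *)
Lemma inr_in_OLD_set S i : OLD_set S -> (inr i : H) \in S.
Proof.
move=> OLD_S; have [ltik|lek] := ltnP i.+1 k.
  apply: (OLD_set_separator (v := inl i : H)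
                            (w := inl (Ordinal ltik) : H) OLD_S).
    by apply/eqP => -[] /(congr1 val)/eqP; rewrite ltn_eqF /=.
  by apply/setP => -[] j; rewrite !inE //= leq_eqVlt eq_sym.
apply: (OLD_set_dominator (v := inl i : H) OLD_S).
apply/setP => -[] j; rewrite !inE //=.
have leji : j <= i by rewrite -ltnS (leq_trans (ltn_ord j)).
by apply/idP/eqP => [leij|[->]//]; congr inr; apply/val_inj/anti_leq/andP.
Qed.

End HalfGraphOLD.

Theorem proposition5 (k : nat) (hk : 1 <= k) :
  locatable (half_graph k) /\ gamma_OL (half_graph k) = 2 * k.
Proof.
split; first exact: half_graph_locatable.
rewrite gamma_OL_card ?half_graph_locatable //.
  by rewrite card_sum card_ord addnn mul2n.
move=> S OLD_S; apply/setP => x; rewrite inE.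
by case: x => i; rewrite ?inl_in_OLD_set ?inr_in_OLD_set.
Qed.
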